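(* Let $M$ be a hyperkähler manifold and let $\{X_n\}_{n=1-j,\dots,j-1}$ be the generators of a trans-tri-Hamiltonian hidden action on $M$. Then one can always redefine the generators $X_n$, by an allowed redefinition, so that they become sections of the bundle $T^{1,0}_{I_0}M$ if $n>0$ and of the bundle $T^{0,1}_{I_0}M$ if $n<0$.
   Context: A hyperkähler manifold is a smooth manifold $M$ of real dimension $4m$ with three symplectic forms $\omega_1,\omega_2,\omega_3$ such that, viewing 2-forms as bundle maps $TM\to T^*M$, the endomorphisms $I_1=\omega_3^{-1}\omega_2$, $I_2=\omega_1^{-1}\omega_3$, $I_3=\omega_2^{-1}\omega_1$ satisfy $I_1^2=I_2^2=I_3^2=I_1I_2I_3=-1$; the metric $g$ is given by $\omega_i(X,Y)=g(X,I_iY)$. Put $I_+=\tfrac12(I_1+iI_2)$, $I_0=I_3$, $I_-=-\tfrac12(I_1-iI_2)$, $\omega_+=\tfrac12(\omega_1+i\omega_2)$, $\omega_0=\omega_3$, $\omega_-=-\tfrac12(\omega_1-i\omega_2)$, and for $\zeta\in\mathbb{C}^\times$: $I(\zeta)=\frac{I_+}{\zeta}+I_0+\zeta I_-$, $\omega(\zeta)=\frac{\omega_+}{\zeta}+\omega_0+\zeta\omega_-$. Let $j>1$ be an integer. A trans-tri-Hamiltonian hidden action is generated by a system of $2j-1$ vector fields $X_n\in T_{\mathbb{C}}M$, $n=1-j,\dots,j-1$ (with $X_n=0$ for other $n$), satisfying the reality condition $\bar X_n=(-1)^nX_{-n}$ and such that, with $X(\zeta)=\sum_{n=1-j}^{j-1}X_n\zeta^{-n}$,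 $\mathcal{L}_{X(\zeta)}\omega(\zeta)=0$ (Lie derivative on $M$ for fixed $\zeta$); i.e. $\mathcal{L}_{X_{n-1}}\omega_++\mathcal{L}_{X_n}\omega_0+\mathcal{L}_{X_{n+1}}\omega_-=0$ for all $n$; it comes with generalized moment maps $\mu_n$ with $\iota_{X_{n-1}}\omega_++\iota_{X_n}\omega_0+\iota_{X_{n+1}}\omega_-=d\mu_n$. An allowed redefinition is $X(\zeta)\mapsto X(\zeta)+I(\zeta)Y(\zeta)$ with $Y(\zeta)=\sum_{n=2-j}^{j-2}Y_n\zeta^{-n}$, i.e. $X_n\mapsto X_n+I_+Y_{n-1}+I_0Y_n+I_-Y_{n+1}$, where the $Y_n\in T_{\mathbb{C}}M$ are arbitrary vector fields subject only to $\bar Y_n=(-1)^nY_{-n}$ ($Y_n=0$ out of range); these leave $\iota_{X(\zeta)}\omega(\zeta)$ and $\mathcal{L}_{X(\zeta)}\omega(\zeta)$ invariant. *)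

(* Defs.v *)
From HB Require Import structures.
From mathcomp Require Import all_boot all_order all_algebra.
From mathcomp Require Import all_classical all_reals all_analysis.
From mathcomp Require Import complex.
Set Implicit Arguments.
Unset Strict Implicit.
Unset Printing Implicit Defensive.
Import Order.TTheory GRing.Theory Num.Theory.
Import numFieldNormedType.Exports.

Local Open Scope classical_set_scope.
Local Open Scope ring_scope.

Section Calculus.
Variables (R : realType) (n : nat).
Implicit Types (U : set 'cV[R]_n) (f : 'cV[R]_n -> R) (h : 'cV[R]_n -> R[i]).

Definition partial (k : 'I_n) f : 'cV[R]_n -> R := 'D_(delta_mx k 0) f.

Fixpoint Ck_on (r : nat) U f : Prop :=
  (forall x, U x -> {for x, continuous f}) /\
  if r is r'.+1 then
    forall k, (forall x, U x -> derivable f x (delta_mx k 0)) /\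
              Ck_on r' U (partial k f)
  else True.

Definition smooth_on U f := forall r, Ck_on r U f.

Definition csmooth_on U h :=
  smooth_on U (fun x => complex.Re (h x)) /\
  smooth_on U (fun x => complex.Im (h x)).

Definition cpartial (k : 'I_n) h (x : 'cV[R]_n) : R[i] :=
  Complex (partial k (fun y => complex.Re (h y)) x)
          (partial k (fun y => complex.Im (h y)) x).

Definition jacobian_matrix (g : 'cV[R]_n -> 'cV[R]_n) (x : 'cV[R]_n) : 'M[R]_n :=
  \matrix_(i, k) partial k (fun y => g y i 0) x.

End Calculus.

(* The maps are total; only their restrictions to source and target matter. *)
Record chart (R : realType) (n : nat) (T : topologicalType) := Chart {
  source : set T;
  target : set 'cV[R]_n;
  coord : T -> 'cV[R]_n;
  param : 'cV[R]_n -> T;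
  open_source : open source;
  open_target : open target;
  coord_target : forall p, source p -> target (coord p);
  param_source : forall x, target x -> source (param x);
  coordK : forall p, source p -> param (coord p) = p;
  paramK : forall x, target x -> coord (param x) = x;
  coord_continuous : {within source, continuous coord};
  param_continuous : {within target, continuous param}
}.

Definition transition (R : realType) n T (c c' : chart R n T) (x : 'cV[R]_n) :=
  coord c' (param c x).

Definition overlap (R : realType) n T (c c' : chart R n T) : set 'cV[R]_n :=
  target c `&` param c @^-1` source c'.

(* The smooth structure is given by an atlas, not necessarily maximal. *)
Record manifold (R : realType) (n : nat) := Manifold {
  points :> topologicalType;
  points_hausdorff : hausdorff_space points;
  points_second_countable : @second_countable points;
  chart_index : Type;
  atlas : chart_index -> chart R n points;
  atlas_cover : forall p : points, exists a, source (atlas a) p;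
  atlas_compatible : forall a b i,
    smooth_on (overlap (atlas a) (atlas b))
              (fun x => transition (atlas a) (atlas b) x i 0)
}.

(* Tensor fields are given by their components in the charts of the atlas: a
   family indexed by the charts, which is only meaningful on the targets of the
   charts, is smooth there, and obeys the tensor transformation law on the
   overlaps. *)
Section Tensors.
Variables (R : realType) (n : nat) (M : manifold R n).

Definition on_charts
    (P : chart_index M -> 'cV[R]_n -> Prop) :=
  forall a x, target (atlas a) x -> P a x.

Definition on_overlaps
    (P : chart_index M -> chart_index M -> 'cV[R]_n -> 'cV[R]_n -> 'M[R]_n -> Prop) :=
  forall a b x, overlap (atlas a) (atlas b) x ->
    let t := transition (atlas a) (atlas b) in
    P a b x (t x) (jacobian_matrix t x).

Definition csmooth_function (f : M -> R[i]) :=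
  forall a, csmooth_on (target (atlas a)) (fun x => f (param (atlas a) x)).

Definition cvfield := chart_index M -> 'cV[R]_n -> 'cV[R[i]]_n.
Definition ccovfield := chart_index M -> 'cV[R]_n -> 'cV[R[i]]_n.
Definition field2 (K : Type) := chart_index M -> 'cV[R]_n -> 'M[K]_n.

Definition cplx_mx p q (A : 'M[R]_(p, q)) : 'M[R[i]]_(p, q) :=
  map_mx (real_complex R) A.

(* Smooth section of the complexified tangent bundle. *)
Definition is_cvfield (X : cvfield) :=
  (forall a i, csmooth_on (target (atlas a)) (fun x => X a x i 0)) /\
  on_overlaps (fun a b x y J => X b y = cplx_mx J *m X a x).

(* The matrix of a bilinear form w has entries w(e_i, e_k). *)
Definition is_2form (w : field2 R) :=
  [/\ forall a i k, smooth_on (target (atlas a)) (fun x => w a x i k),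
      on_charts (fun a x => (w a x)^T = - w a x) &
      on_overlaps (fun a b x y J => w a x = J^T *m w b y *m J)].

Definition closed_2form (w : field2 R) :=
  on_charts (fun a x => forall i k l,
    partial i (fun y => w a y k l) x + partial k (fun y => w a y l i) x
    + partial l (fun y => w a y i k) x = 0).

(* Matrix of the bundle map TM -> T*M, v |-> w(v, -), covectors being written
   as columns. *)
Definition flat (K : Type) (A : 'M[K]_n) : 'M[K]_n := A^T.

Definition nondegenerate_2form (w : field2 R) :=
  on_charts (fun a x => flat (w a x) \in unitmx).

Definition symplectic (w : field2 R) :=
  [/\ is_2form w, closed_2form w & nondegenerate_2form w].

Definition contraction (X : cvfield) (w : field2 R[i]) : ccovfield :=
  fun a x => flat (w a x) *m X a x.

Definition exterior_d (f : M -> R[i]) : ccovfield :=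
  fun a x => \col_k cpartial k (fun y => f (param (atlas a) y)) x.

Definition Lie_derivative (X : cvfield) (w : field2 R[i]) : field2 R[i] :=
  fun a x => \matrix_(i, k) \sum_l
    (X a x l 0 * cpartial l (fun y => w a y i k) x
     + w a x l k * cpartial i (fun y => X a y l 0) x
     + w a x i l * cpartial k (fun y => X a y l 0) x).

End Tensors.

Section Quaternionic.
Variables (R : realType) (n : nat) (M : manifold R n).
Variables (w1 w2 w3 : field2 M R).

Definition sharp_flat (u v : field2 M R) : field2 M R :=
  fun a x => invmx (flat (u a x)) *m flat (v a x).

Definition quaternionic_relations :=
  on_charts (fun a x =>
    let I1 := sharp_flat w3 w2 a x in
    let I2 := sharp_flat w1 w3 a x in
    let I3 := sharp_flat w2 w1 a x in
    [/\ I1 *m I1 = - 1%:M, I2 *m I2 = - 1%:M, I3 *m I3 = - 1%:M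
      & I1 *m I2 *m I3 = - 1%:M]).

End Quaternionic.

(* The metric is not part of the data: it is recovered from the forms by
   omega_i(X, Y) = g(X, I_i Y). Its signature is left unconstrained. *)
Record hyperkahler (R : realType) (m : nat) := Hyperkahler {
  hk_manifold :> manifold R (4 * m);
  omega1 : field2 hk_manifold R;
  omega2 : field2 hk_manifold R;
  omega3 : field2 hk_manifold R;
  omega1_symplectic : symplectic omega1;
  omega2_symplectic : symplectic omega2;
  omega3_symplectic : symplectic omega3;
  hk_quaternionic : quaternionic_relations omega1 omega2 omega3
}.

Arguments omega1 {R m} h.
Arguments omega2 {R m} h.
Arguments omega3 {R m} h.

Section HiddenActions.
Variables (R : realType) (m : nat) (M : hyperkahler R m).

Let ii : R[i] := Complex 0 1.

Definition plus_part (u v : field2 M R) : field2 M R[i] :=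
  fun a x => 2^-1 *: (cplx_mx (u a x) + ii *: cplx_mx (v a x)).
Definition minus_part (u v : field2 M R) : field2 M R[i] :=
  fun a x => - (2^-1 *: (cplx_mx (u a x) - ii *: cplx_mx (v a x))).

Definition omega_plus := plus_part (omega1 M) (omega2 M).
Definition omega_zero : field2 M R[i] := fun a x => cplx_mx (omega3 M a x).
Definition omega_minus := minus_part (omega1 M) (omega2 M).

Definition struct1 : field2 M R := sharp_flat (omega3 M) (omega2 M).
Definition struct2 : field2 M R := sharp_flat (omega1 M) (omega3 M).
Definition struct3 : field2 M R := sharp_flat (omega2 M) (omega1 M).

Definition I_plus := plus_part struct1 struct2.
Definition I_zero : field2 M R[i] := fun a x => cplx_mx (struct3 a x).
Definition I_minus := minus_part struct1 struct2.

(* X n is the coefficient of zeta^-n. *)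
Implicit Types X Y : int -> cvfield M.

Definition supported (d : int) X :=
  forall n, ~~ (- d <= n <= d) -> on_charts (fun a x => X n a x = 0).

Definition reality X :=
  forall n, on_charts (fun a x =>
    map_mx conjc (X n a x) = (-1) ^ n *: X (- n) a x).

Record hidden_action (j : int) X : Prop := HiddenAction {
  ha_vfield : forall n, is_cvfield (X n);
  ha_supported : supported (j - 1) X;
  ha_reality : reality X;
  ha_Lie : forall n, on_charts (fun a x =>
    Lie_derivative (X (n - 1)) omega_plus a x
    + Lie_derivative (X n) omega_zero a x
    + Lie_derivative (X (n + 1)) omega_minus a x = 0);
  ha_moment : exists mu : int -> M -> R[i], forall n,
    csmooth_function (mu n) /\
    on_charts (fun a x =>
      contraction (X (n - 1)) omega_plus a x
      + contraction (X n) omega_zero a x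
      + contraction (X (n + 1)) omega_minus a x = exterior_d (mu n) a x)
}.

Record redefinition_field (j : int) Y : Prop := RedefinitionField {
  rf_vfield : forall n, is_cvfield (Y n);
  rf_supported : supported (j - 2) Y;
  rf_reality : reality Y
}.

Definition redefine X Y : int -> cvfield M := fun n a x =>
  X n a x + I_plus a x *m Y (n - 1) a x + I_zero a x *m Y n a x
  + I_minus a x *m Y (n + 1) a x.

(* The fibre of T^{1,0} (resp. T^{0,1}) is the i- (resp. -i-) eigenspace of
   I_0 on the complexified tangent space. *)
Definition section_T10 (V : cvfield M) :=
  is_cvfield V /\ on_charts (fun a x => I_zero a x *m V a x = ii *: V a x).
Definition section_T01 (V : cvfield M) :=
  is_cvfield V /\ on_charts (fun a x => I_zero a x *m V a x = - ii *: V a x).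

End HiddenActions.

(* Main.v *)
Require Import Defs.
From mathcomp Require Import all_boot all_order all_algebra.
From mathcomp Require Import all_classical all_reals all_analysis.
From mathcomp Require Import complex ring zify.
Set Implicit Arguments.
Unset Strict Implicit.
Unset Printing Implicit Defensive.
Import Order.TTheory GRing.Theory Num.Theory.
Import numFieldNormedType.Exports.
Local Open Scope ring_scope.

(** The quaternion relations say that I_0 acts by -i on the image of I_+ and by
    i on the image of I_-, that I_+ and I_- square to zero, and that
    I_+ I_- + I_- I_+ = 1.  Hence I_+ I_- and I_- I_+ are the projectors onto
    T^{0,1} and T^{1,0}: I_+ maps T^{1,0} isomorphically onto T^{0,1}, with
    inverse I_-.

    For n > 0 the T^{0,1} part of the redefined X_n is that of X_n plus
    I_+ Y_{n-1} plus the T^{0,1} part of I_0 Y_n.  So if Y_n is taken in T^{1,0}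
    for n > 0, that part vanishes as soon as I_+ Y_{n-1} = - I_+ I_- X_n, and
    the T^{1,0} solution is Y_{n-1} = - I_- X_n.  The conditions for n < 0 are
    the complex conjugates of these and give Y_{n+1} = - I_+ X_n with values
    in T^{0,1}.  Both prescriptions meet only at n = 0, where they fix the two
    types of Y_0 separately and are added: see [normalizing_field].  As the top
    index of X is j - 1, that of Y is j - 2, and the reality of Y follows
    from that of X since conjugation exchanges I_+ with - I_-.  The redefined
    generators are then visibly in the image of I_- for n > 0 and of I_+ for
    n < 0 ([redefine_pos], [redefine_neg]).

    All this is linear algebra at a point.  What remains is to see that the
    fields so obtained are smooth sections, which amounts to I_+, I_0 and I_-
    being smooth tensor fields ([is_endofield_sharp_flat]).  Their components
    involve the inverse matrix of a symplectic form, so smooth functions have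
    to be closed under sums, products and inverses, and then matrix inversion
    is handled by Cramer's rule ([smooth_mx_on_inv]). *)

(** * Smooth real functions and matrices *)

Section SmoothFunctions.
Variables (R : realType) (n : nat) (U : set 'cV[R]_n).
Hypothesis openU : open U.
Implicit Types (f g : 'cV[R]_n -> R) (r : nat).

Lemma near_eq_on f g x : {in U, f =1 g} -> U x -> \near x, f x = g x.
Proof.
move=> fg Ux; apply: filterS (open_nbhs_nbhs (conj openU Ux)) => y Uy.
by apply: fg; rewrite inE.
Qed.

Lemma continuous_on_eq f g : {in U, f =1 g} ->
  (forall x, U x -> {for x, continuous f}) ->
  forall x, U x -> {for x, continuous g}.
Proof.
move=> fg cf x Ux; have gx : g x = f x by rewrite fg ?inE.
rewrite /prop_for /continuous_at gx; apply: cvg_trans (cf x Ux).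
exact: near_eq_cvg (near_eq_on fg Ux).
Qed.

(** Partial derivatives are local, so the values off the open set [U] do not
    matter.  This is what allows the rules of differentiation, which hold on
    [U] only, to be used as rewriting rules in the inductions below. *)
Lemma Ck_on_eq r f g : {in U, f =1 g} -> Ck_on r U f -> Ck_on r U g.
Proof.
elim: r f g => [|r IHr] f g fg [cf df];
  (split; first exact: continuous_on_eq fg cf) => // k.
have [dfk cfk] := df k; split => [x Ux|].
  exact: near_eq_derivable (near_eq_on fg Ux) (dfk x Ux).
apply: IHr cfk => x; rewrite inE => Ux.
exact: near_eq_derive (near_eq_on fg Ux).
Qed.

Lemma Ck_on_pred r f : Ck_on r.+1 U f -> Ck_on r U f.
Proof.
elim: r f => [|r IHr] f [cf df]; split => // k.
by have [dfk cfk] := df k; split => //; exact: IHr.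
Qed.

Lemma Ck_on_cst r (c : R) : Ck_on r U (cst c).
Proof.
elim: r c => [|r IHr] c;
  (split; first by move=> x _; exact: cst_continuous) => // k.
split => [x _|]; first exact: derivable_cst.
by apply: Ck_on_eq (IHr 0) => x _; rewrite /partial derive_cst.
Qed.

Lemma Ck_onD r f g :
  Ck_on r U f -> Ck_on r U g -> Ck_on r U (fun x => f x + g x).
Proof.
elim: r f g => [|r IHr] f g [cf df] [cg dg];
  (split; first by move=> x Ux; exact: continuousD (cf x Ux) (cg x Ux)) => // k.
have [dfk cfk] := df k; have [dgk cgk] := dg k; split => [x Ux|].
  exact: derivableD (dfk x Ux) (dgk x Ux).
apply: Ck_on_eq (IHr _ _ cfk cgk) => x; rewrite inE => Ux.
by rewrite /partial -deriveD //; [exact: dfk | exact: dgk].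
Qed.

(** By induction on [r], as the partial derivative of [f * g] is a sum of
    products of functions that are of class C^r when [f] and [g] are of class
    C^(r+1). *)
Lemma Ck_onM r f g :
  Ck_on r U f -> Ck_on r U g -> Ck_on r U (fun x => f x * g x).
Proof.
elim: r f g => [|r IHr] f g Cf Cg; have [cf df] := Cf; have [cg dg] := Cg;
  (split; first by move=> x Ux; exact: continuousM (cf x Ux) (cg x Ux)) => // k.
have [dfk cfk] := df k; have [dgk cgk] := dg k; split => [x Ux|].
  exact: derivableM (dfk x Ux) (dgk x Ux).
have Cfg := Ck_onD (IHr _ _ (Ck_on_pred Cf) cgk) (IHr _ _ (Ck_on_pred Cg) cfk).
apply: Ck_on_eq Cfg => x; rewrite inE => Ux; rewrite /partial.
exact/esym/(deriveM (dfk x Ux) (dgk x Ux)).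
Qed.

(** By induction on [r], as the partial derivative of [1 / f] is a product of
    that of [f] with [1 / f] itself, of class C^r by induction. *)
Lemma Ck_onV r f : {in U, forall x, f x != 0} ->
  Ck_on r U f -> Ck_on r U (fun x => (f x)^-1).
Proof.
move=> f0; have f_neq0 x : U x -> f x != 0 by move=> Ux; rewrite f0 ?inE.
elim: r => [|r IHr] Cf; have [cf df] := Cf;
  (split; first by move=> x Ux; exact: continuousV (f_neq0 x Ux) (cf x Ux))
  => // k.
have [dfk cfk] := df k; split => [x Ux|].
  exact: derivableV (f_neq0 x Ux) (dfk x Ux).
have Cfr := IHr (Ck_on_pred Cf).
apply: Ck_on_eq (Ck_onM (Ck_onM (Ck_on_cst r (-1)) (Ck_onM Cfr Cfr)) cfk) => x.
rewrite inE => Ux; rewrite /partial (deriveV (f_neq0 x Ux) (dfk x Ux)).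
by rewrite /= -exprVn expr2 mulN1r.
Qed.

Lemma smooth_on_eq f g : {in U, f =1 g} -> smooth_on U f -> smooth_on U g.
Proof. by move=> fg Sf r; apply: Ck_on_eq (Sf r). Qed.

Lemma smooth_on_cst (c : R) : smooth_on U (fun=> c).
Proof. by move=> r; exact: Ck_on_cst. Qed.

Lemma smooth_onD f g :
  smooth_on U f -> smooth_on U g -> smooth_on U (fun x => f x + g x).
Proof. by move=> Sf Sg r; exact: Ck_onD. Qed.

Lemma smooth_onM f g :
  smooth_on U f -> smooth_on U g -> smooth_on U (fun x => f x * g x).
Proof. by move=> Sf Sg r; exact: Ck_onM. Qed.

Lemma smooth_onV f : {in U, forall x, f x != 0} ->
  smooth_on U f -> smooth_on U (fun x => (f x)^-1).
Proof. by move=> f0 Sf r; exact: Ck_onV. Qed.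

Lemma smooth_onN f : smooth_on U f -> smooth_on U (fun x => - f x).
Proof.
move=> Sf; apply: smooth_on_eq (smooth_onM (smooth_on_cst (-1)) Sf) => x _.
by rewrite mulN1r.
Qed.

Lemma smooth_on_sum (I : Type) (s : seq I) (F : I -> 'cV[R]_n -> R) :
  (forall i, smooth_on U (F i)) -> smooth_on U (fun x => \sum_(i <- s) F i x).
Proof.
move=> SF; elim: s => [|i s IHs].
  by apply: smooth_on_eq (smooth_on_cst 0) => x _; rewrite big_nil.
by apply: smooth_on_eq (smooth_onD (SF i) IHs) => x _; rewrite big_cons.
Qed.

Lemma smooth_on_prod (I : Type) (s : seq I) (F : I -> 'cV[R]_n -> R) :
  (forall i, smooth_on U (F i)) -> smooth_on U (fun x => \prod_(i <- s) F i x).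
Proof.
move=> SF; elim: s => [|i s IHs].
  by apply: smooth_on_eq (smooth_on_cst 1) => x _; rewrite big_nil.
by apply: smooth_on_eq (smooth_onM (SF i) IHs) => x _; rewrite big_cons.
Qed.

Definition smooth_mx_on p q (A : 'cV[R]_n -> 'M[R]_(p, q)) :=
  forall i k, smooth_on U (fun x => A x i k).

Lemma smooth_mx_onM p q s (A : 'cV[R]_n -> 'M[R]_(p, q))
    (B : 'cV[R]_n -> 'M[R]_(q, s)) :
  smooth_mx_on A -> smooth_mx_on B -> smooth_mx_on (fun x => A x *m B x).
Proof.
move=> SA SB i k; have SAB l := smooth_onM (SA i l) (SB l k).
by apply: smooth_on_eq (smooth_on_sum (index_enum _) SAB) => x _; rewrite mxE.
Qed.

Lemma smooth_on_det p (A : 'cV[R]_n -> 'M[R]_p) :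
  smooth_mx_on A -> smooth_on U (fun x => \det (A x)).
Proof.
move=> SA; apply: smooth_on_sum => s; apply: smooth_onM.
  exact: smooth_on_cst.
by apply: smooth_on_prod => i; exact: SA.
Qed.

(** Cramer's rule: the entries of the inverse are polynomials in the entries of
    the matrix, divided by the determinant. *)
Lemma smooth_mx_on_inv p (A : 'cV[R]_n -> 'M[R]_p) :
  {in U, forall x, A x \in unitmx} -> smooth_mx_on A ->
  smooth_mx_on (fun x => invmx (A x)).
Proof.
move=> uA SA i k.
have Sadj : smooth_on U (fun x => (\adj (A x)) i k).
  have Scof : smooth_on U (fun x => cofactor (A x) k i).
    apply: smooth_onM; first exact: smooth_on_cst.
    apply: smooth_on_det => a b; apply: smooth_on_eq (SA _ _) => x _.
    by rewrite !mxE.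
  by apply: smooth_on_eq Scof => x _; rewrite mxE.
have det_neq0 : {in U, forall x, \det (A x) != 0}.
  by move=> x /uA; rewrite unitmxE unitfE.
have SV := smooth_onV det_neq0 (smooth_on_det SA).
apply: smooth_on_eq (smooth_onM SV Sadj) => x Ux.
by rewrite /invmx uA // [RHS]mxE.
Qed.
End SmoothFunctions.

(** * Smooth complex functions *)

Section ComplexSmoothFunctions.
Variables (R : realType) (n : nat) (U : set 'cV[R]_n).
Hypothesis openU : open U.
Implicit Types h k : 'cV[R]_n -> R[i].

Lemma csmooth_on_cst (c : R[i]) : csmooth_on U (fun=> c).
Proof. by split; exact: smooth_on_cst. Qed.

Lemma csmooth_onD h k :
  csmooth_on U h -> csmooth_on U k -> csmooth_on U (fun x => h x + k x).
Proof.
move=> [hr hi] [kr ki]; split.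
  apply: smooth_on_eq (smooth_onD openU hr kr) => // x _.
  by case: (h x) (k x) => [? ?] [].
apply: smooth_on_eq (smooth_onD openU hi ki) => // x _.
by case: (h x) (k x) => [? ?] [].
Qed.

Lemma csmooth_onM h k :
  csmooth_on U h -> csmooth_on U k -> csmooth_on U (fun x => h x * k x).
Proof.
move=> [hr hi] [kr ki]; split.
  have S := smooth_onD openU (smooth_onM openU hr kr)
                             (smooth_onN openU (smooth_onM openU hi ki)).
  by apply: smooth_on_eq S => // x _; case: (h x) (k x) => [? ?] [].
have S := smooth_onD openU (smooth_onM openU hr ki) (smooth_onM openU hi kr).
by apply: smooth_on_eq S => // x _; case: (h x) (k x) => [? ?] [].
Qed.

Lemma csmooth_on_eq h k : h =1 k -> csmooth_on U h -> csmooth_on U k.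
Proof. by move=> /funext ->. Qed.

Lemma csmooth_on_sum (I : Type) (s : seq I) (F : I -> 'cV[R]_n -> R[i]) :
  (forall i, csmooth_on U (F i)) ->
  csmooth_on U (fun x => \sum_(i <- s) F i x).
Proof.
move=> SF; elim: s => [|i s IHs].
  by apply: csmooth_on_eq (csmooth_on_cst 0) => x; rewrite big_nil.
by apply: csmooth_on_eq (csmooth_onD (SF i) IHs) => x; rewrite big_cons.
Qed.

Lemma csmooth_on_real (f : 'cV[R]_n -> R) :
  smooth_on U f -> csmooth_on U (fun x => real_complex R (f x)).
Proof. by move=> Sf; split=> //; exact: smooth_on_cst. Qed.

End ComplexSmoothFunctions.

(** * Vector fields and endomorphism fields *)

Section VectorFields.
Variables (R : realType) (n : nat) (M : manifold R n).
Implicit Types (X Y : cvfield M) (A B : field2 M R[i]) (u v : field2 M R).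

Let opent (a : chart_index M) : open (target (atlas a)) := @open_target _ _ _ _.
Arguments opent : clear implicits.

(** Smooth sections of End(TM) tensored with the complex numbers. *)
Definition is_endofield A :=
  (forall a i k, csmooth_on (target (atlas a)) (fun x => A a x i k)) /\
  on_overlaps (fun a b x y J => cplx_mx J *m A a x = A b y *m cplx_mx J).

Lemma is_cvfield0 : is_cvfield ((fun _ _ => 0) : cvfield M).
Proof.
split => [a i|a b x _ /=]; last by rewrite mulmx0.
by apply: csmooth_on_eq (csmooth_on_cst (opent a) 0) => x; rewrite mxE.
Qed.

Lemma is_cvfieldD X Y : is_cvfield X -> is_cvfield Y ->
  is_cvfield (fun a x => X a x + Y a x).
Proof.
move=> [SX TX] [SY TY]; split => [a i|a b x xab /=].
  apply: csmooth_on_eq (csmooth_onD (opent a) (SX a i) (SY a i)) => x.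
  by rewrite mxE.
by rewrite mulmxDr (TX _ _ _ xab) (TY _ _ _ xab).
Qed.

Lemma is_cvfieldZ (c : R[i]) X : is_cvfield X ->
  is_cvfield (fun a x => c *: X a x).
Proof.
move=> [SX TX]; split => [a i|a b x xab /=].
  have Sc := csmooth_on_cst (opent a) c.
  by apply: csmooth_on_eq (csmooth_onM (opent a) Sc (SX a i)) => x; rewrite mxE.
by rewrite -scalemxAr (TX _ _ _ xab).
Qed.

Lemma is_cvfield_mul A X : is_endofield A -> is_cvfield X ->
  is_cvfield (fun a x => A a x *m X a x).
Proof.
move=> [SA TA] [SX TX]; split => [a i|a b x xab /=].
  have SAX l := csmooth_onM (opent a) (SA a i l) (SX a l).
  have S := csmooth_on_sum (opent a) (index_enum _) SAX.
  by apply: csmooth_on_eq S => x; rewrite mxE.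
by rewrite (TX _ _ _ xab) mulmxA -(TA _ _ _ xab) mulmxA.
Qed.

Lemma is_endofieldD A B : is_endofield A -> is_endofield B ->
  is_endofield (fun a x => A a x + B a x).
Proof.
move=> [SA TA] [SB TB]; split => [a i k|a b x xab /=].
  apply: csmooth_on_eq (csmooth_onD (opent a) (SA a i k) (SB a i k)) => x.
  by rewrite mxE.
by rewrite mulmxDr mulmxDl (TA _ _ _ xab) (TB _ _ _ xab).
Qed.

Lemma is_endofieldZ (c : R[i]) A : is_endofield A ->
  is_endofield (fun a x => c *: A a x).
Proof.
move=> [SA TA]; split => [a i k|a b x xab /=].
  have Sc := csmooth_on_cst (opent a) c.
  apply: csmooth_on_eq (csmooth_onM (opent a) Sc (SA a i k)) => x.
  by rewrite mxE.
by rewrite -scalemxAr -scalemxAl (TA _ _ _ xab).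
Qed.

(** If [J] is the Jacobian matrix of a transition map, both forms pull back by
    [w |-> J^T w J], so that [u^-1 v] is conjugated by [J].  That [J] is
    invertible also follows from this rule, since [u] is nondegenerate. *)
Lemma is_endofield_sharp_flat u v : symplectic u -> symplectic v ->
  is_endofield (fun a x => cplx_mx (sharp_flat u v a x)).
Proof.
move=> [[Su _ Tu] _ ndu] [[Sv _ Tv] _ _]; split => [a i k|a b x xab /=].
  have oa := opent a.
  have Sfu : smooth_mx_on (target (atlas a)) (fun x => flat (u a x)).
    by move=> p q; apply: smooth_on_eq (Su a q p) => // x _; rewrite mxE.
  have Sfv : smooth_mx_on (target (atlas a)) (fun x => flat (v a x)).
    by move=> p q; apply: smooth_on_eq (Sv a q p) => // x _; rewrite mxE.
  have uu : {in target (atlas a), forall x, flat (u a x) \in unitmx}.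
    by move=> x; rewrite inE; exact: ndu.
  have S := smooth_mx_onM oa (smooth_mx_on_inv oa uu Sfu) Sfv.
  by apply: csmooth_on_eq (csmooth_on_real oa (S i k)) => x; rewrite [RHS]mxE.
set y := transition _ _ x; set J := jacobian_matrix _ x.
have uu : flat (u a x) \in unitmx by apply: ndu; case: xab.
have uub : flat (u b y) \in unitmx.
  by apply: ndu; apply: coord_target; case: xab.
have Eu : flat (u a x) = J^T *m flat (u b y) *m J.
  by rewrite /flat (Tu _ _ _ xab) !trmx_mul trmxK mulmxA.
have Ev : flat (v a x) = J^T *m flat (v b y) *m J.
  by rewrite /flat (Tv _ _ _ xab) !trmx_mul trmxK mulmxA.
have uJ : J \in unitmx.
  by move: uu; rewrite Eu unitmx_mul => /andP[].
have uJT : J^T \in unitmx by rewrite unitmx_tr.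
rewrite /cplx_mx -!map_mxM /=; congr (map_mx _ _).
rewrite /sharp_flat.
apply: (can_inj (mulKmx (_ : J^T *m flat (u b y) \in unitmx))).
  by rewrite unitmx_mul uJT.
by rewrite !mulmxA -Eu mulmxK // mulmxV // mul1mx -Ev.
Qed.

End VectorFields.

(** * Quaternionic algebra *)

Section Quaternions.
Variables (F : comPzRingType) (n : nat) (I J K : 'M[F]_n).
Hypotheses (II : I *m I = - 1%:M) (JJ : J *m J = - 1%:M).
Hypotheses (KK : K *m K = - 1%:M) (IJK : I *m J *m K = - 1%:M).

Lemma quaternion_mulIJ : I *m J = K.
Proof.
rewrite -[I *m J]mulmx1 -[1%:M]opprK -KK mulmxN mulmxA IJK.
by rewrite mulNmx mul1mx opprK.
Qed.

Lemma quaternion_mulJI : J *m I = - K.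
Proof.
(* The relation (IJ)^2 = K^2 = -1 gives JIJ = I, as I is invertible. *)
have E : I *m (J *m I *m J) = - 1%:M by rewrite -KK -quaternion_mulIJ !mulmxA.
have {}E : J *m I *m J = I.
  rewrite -[LHS]mul1mx -[1%:M]opprK -II mulNmx -(mulmxA I) E.
  by rewrite mulmxN mulmx1 opprK.
by rewrite -quaternion_mulIJ -{2}E -mulmxA JJ mulmxN mulmx1 opprK.
Qed.

(** I_+ and I_- are both combinations of I and J, and all their products are
    instances of this one. *)
Lemma quaternion_mul_comb (a b c d : F) :
  (a *: I + b *: J) *m (c *: I + d *: J) =
  - (a * c + b * d) *: 1%:M + (a * d - b * c) *: K.
Proof.
rewrite mulmxDl !mulmxDr -!scalemxAl -!scalemxAr II JJ quaternion_mulIJ.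
by rewrite quaternion_mulJI; apply/matrixP => r s; rewrite !mxE; ring.
Qed.

Lemma quaternion_mulK_comb (a b : F) :
  K *m (a *: I + b *: J) = a *: J - b *: I.
Proof.
rewrite mulmxDr -!scalemxAr -quaternion_mulIJ -!mulmxA quaternion_mulJI JJ.
rewrite -quaternion_mulIJ mulmxN mulmxA II mulNmx mul1mx opprK.
by rewrite mulmxN mulmx1 scalerN.
Qed.

End Quaternions.

(** * The structures I_+, I_0 and I_- *)

Section HiddenActionRedefinition.
Variables (R : realType) (m : nat) (M : hyperkahler R m).
Let ii : R[i] := Complex 0 1.

Lemma mul_ii : ii * ii = -1.
Proof. by rewrite -expr2 sqr_i. Qed.

Lemma conjc_ii : conjc ii = - ii.
Proof. by apply/eqP; rewrite eq_complex /= oppr0 !eqxx. Qed.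

Lemma mul_ii_half : ii * (2^-1 * ii) = - 2^-1.
Proof. by rewrite mulrCA mul_ii mulrN1. Qed.

Lemma plus_partE (u v : field2 M R) a x :
  plus_part u v a x = 2^-1 *: cplx_mx (u a x) + (2^-1 * ii) *: cplx_mx (v a x).
Proof. by rewrite /plus_part scalerDr scalerA. Qed.

Lemma minus_partE (u v : field2 M R) a x :
  minus_part u v a x =
  - 2^-1 *: cplx_mx (u a x) + (2^-1 * ii) *: cplx_mx (v a x).
Proof. by rewrite /minus_part scalerBr scalerA opprB addrC scaleNr. Qed.

Lemma is_endofield_I_plus : is_endofield (@I_plus R m M).
Proof.
have E1 := is_endofield_sharp_flat (omega3_symplectic M) (omega2_symplectic M).
have E2 := is_endofield_sharp_flat (omega1_symplectic M) (omega3_symplectic M).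
have -> : @I_plus R m M = fun a x => 2^-1 *: cplx_mx (struct1 a x) +
                                     (2^-1 * ii) *: cplx_mx (struct2 a x).
  by apply/funext => a; apply/funext => x; exact: plus_partE.
exact: is_endofieldD (is_endofieldZ _ E1) (is_endofieldZ _ E2).
Qed.

Lemma is_endofield_I_minus : is_endofield (@I_minus R m M).
Proof.
have E1 := is_endofield_sharp_flat (omega3_symplectic M) (omega2_symplectic M).
have E2 := is_endofield_sharp_flat (omega1_symplectic M) (omega3_symplectic M).
have -> : @I_minus R m M = fun a x => - 2^-1 *: cplx_mx (struct1 a x) +
                                      (2^-1 * ii) *: cplx_mx (struct2 a x).
  by apply/funext => a; apply/funext => x; exact: minus_partE.
exact: is_endofieldD (is_endofieldZ _ E1) (is_endofieldZ _ E2).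
Qed.

Lemma is_endofield_I_zero : is_endofield (@I_zero R m M).
Proof.
exact: is_endofield_sharp_flat (omega2_symplectic M) (omega1_symplectic M).
Qed.

Section Pointwise.
Variables (a : chart_index M) (x : 'cV[R]_(4 * m)).
Hypothesis tx : target (atlas a) x.
Let P := @I_plus R m M a x.
Let Z := @I_zero R m M a x.
Let Q := @I_minus R m M a x.
Let I1 := cplx_mx (@struct1 R m M a x).
Let I2 := cplx_mx (@struct2 R m M a x).

Lemma complexified_quaternions :
  [/\ I1 *m I1 = - 1%:M, I2 *m I2 = - 1%:M, Z *m Z = - 1%:M
    & I1 *m I2 *m Z = - 1%:M].
Proof.
have [h1 h2 h3 h4] := @hk_quaternionic R m M a x tx.
rewrite /Z /I_zero /I1 /I2 /struct1 /struct2 /struct3 /cplx_mx -!map_mxM.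
by rewrite h1 h2 h3 h4 map_mxN map_mx1.
Qed.

Lemma I_zero_plus : Z *m P = - ii *: P.
Proof.
have [h1 h2 h3 h4] := complexified_quaternions.
rewrite /P /I_plus plus_partE (quaternion_mulK_comb h1 h2 h3 h4).
rewrite scalerDr !scalerA.
by rewrite !mulNr mul_ii_half opprK [ii * _]mulrC scaleNr addrC.
Qed.

Lemma I_zero_minus : Z *m Q = ii *: Q.
Proof.
have [h1 h2 h3 h4] := complexified_quaternions.
rewrite /Q /I_minus minus_partE (quaternion_mulK_comb h1 h2 h3 h4).
rewrite scalerDr !scalerA.
by rewrite mul_ii_half mulrN [ii * _]mulrC addrC !scaleNr addrC.
Qed.

Lemma I_plus_plus : P *m P = 0.
Proof.
have [h1 h2 h3 h4] := complexified_quaternions.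
rewrite /P /I_plus !plus_partE (quaternion_mul_comb h1 h2 h3 h4).
by rewrite mulrACA mul_ii mulrN1 addrN oppr0 mulrAC mulrA addrN !scale0r addr0.
Qed.

Lemma I_minus_minus : Q *m Q = 0.
Proof.
have [h1 h2 h3 h4] := complexified_quaternions.
rewrite /Q /I_minus !minus_partE (quaternion_mul_comb h1 h2 h3 h4).
rewrite mulrACA mul_ii mulrN1 mulrNN addrN oppr0.
by rewrite [_ * - _]mulrC addrN !scale0r addr0.
Qed.

(** The two products are (1 + i I_0)/2 and (1 - i I_0)/2, the projectors onto
    the two eigenspaces of I_0. *)
Lemma I_plus_minus_anticomm : P *m Q + Q *m P = 1%:M.
Proof.
have [h1 h2 h3 h4] := complexified_quaternions.
rewrite /P /Q /I_plus /I_minus plus_partE minus_partE.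
rewrite !(quaternion_mul_comb h1 h2 h3 h4) addrACA -!scalerDl.
have -> : 2^-1 * (2^-1 * ii) - 2^-1 * ii * - 2^-1 +
  (- 2^-1 * (2^-1 * ii) - 2^-1 * ii * 2^-1) = 0 by ring.
rewrite scale0r addr0 mulrACA mul_ii.
have -> : - (2^-1 * - 2^-1 + 2^-1 * 2^-1 * -1) +
  - (- 2^-1 * 2^-1 + 2^-1 * 2^-1 * -1) = 1 :> R[i] by field.
by rewrite scale1r.
Qed.

Lemma conj_I_plus : map_mx conjc P = - Q.
Proof.
have conj_scale (c : R[i]) p q (A : 'M[R]_(p, q)) :
    map_mx conjc (c *: cplx_mx A) = conjc c *: cplx_mx A.
  apply/matrixP => r s; rewrite !mxE rmorphM; congr (_ * _).
  exact: conjc_real.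
have conj_half : conjc (2^-1 : R[i]) = 2^-1 by rewrite fmorphV rmorph_nat.
have conj_half_ii : conjc (2^-1 * ii) = - (2^-1 * ii).
  by rewrite rmorphM -mulrN; congr (_ * _); [exact: conj_half|exact: conjc_ii].
rewrite /P /Q /I_plus /I_minus plus_partE minus_partE map_mxD !conj_scale.
by rewrite conj_half conj_half_ii !scaleNr opprD opprK.
Qed.

Lemma conj_I_minus : map_mx conjc Q = - P.
Proof.
rewrite -[Q]opprK -conj_I_plus map_mxN; congr (- _).
by apply/matrixP => r s; rewrite !mxE; exact: conjcK.
Qed.

End Pointwise.

(** * The redefinition *)

(** On T^{1,0} the inverse of I_+ is I_-, so the first summand cancels the
    T^{0,1} part of the redefined [X (n + 1)], and the second one the T^{1,0}
    part of the redefined [X (n - 1)].  Both are present at [n = 0]. *)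
Definition normalizing_field (X : int -> cvfield M) : int -> cvfield M :=
  fun n a x =>
    - ((if 0 <= n then I_minus a x *m X (n + 1) a x else 0) +
       (if n <= 0 then I_plus a x *m X (n - 1) a x else 0)).

Lemma is_cvfield_normalizing_field X n : (forall k, is_cvfield (X k)) ->
  is_cvfield (normalizing_field X n).
Proof.
move=> hX; have HQ := is_cvfield_mul is_endofield_I_minus (hX (n + 1)).
have HP := is_cvfield_mul is_endofield_I_plus (hX (n - 1)).
have H0 := is_cvfield0 M.
(* The conditionals now choose between vector fields, not between values. *)
have -> : normalizing_field X n = fun a x =>
    -1 *: ((if 0 <= n then fun a x => I_minus a x *m X (n + 1) a x
            else fun _ _ => 0) a x +
           (if n <= 0 then fun a x => I_plus a x *m X (n - 1) a x
            else fun _ _ => 0) a x).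
  apply/funext => a; apply/funext => x; rewrite /normalizing_field scaleN1r.
  by case: ifP; case: ifP.
apply: is_cvfieldZ; apply: is_cvfieldD; first by case: ifP.
by case: ifP.
Qed.

Lemma is_cvfield_redefine (X Y : int -> cvfield M) n :
  (forall k, is_cvfield (X k)) -> (forall k, is_cvfield (Y k)) ->
  is_cvfield (redefine X Y n).
Proof.
move=> hX hY; apply: is_cvfieldD; first apply: is_cvfieldD;
  first apply: is_cvfieldD => //.
- exact: is_cvfield_mul is_endofield_I_plus (hY _).
- exact: is_cvfield_mul is_endofield_I_zero (hY _).
- exact: is_cvfield_mul is_endofield_I_minus (hY _).
Qed.

Lemma supported_normalizing_field (j : int) (X : int -> cvfield M) : 1 < j ->
  supported (j - 1) X -> supported (j - 2) (normalizing_field X).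
Proof.
move=> j1 sX n jn a x tx; rewrite /normalizing_field.
have -> : (if 0 <= n then I_minus a x *m X (n + 1) a x else 0) = 0.
  by case: ifP => // n0; rewrite sX ?mulmx0 //; lia.
rewrite add0r; case: ifP => [n0|_]; last exact: oppr0.
by rewrite sX ?mulmx0 ?oppr0 //; lia.
Qed.

(** Conjugation exchanges the two summands of [normalizing_field]: it replaces
    I_- by - I_+ and X_{n+1} by (-1)^(n+1) X_{-n-1}, and the two signs combine
    to (-1)^n. *)
Lemma reality_normalizing_field (X : int -> cvfield M) :
  reality X -> reality (normalizing_field X).
Proof.
move=> rX n a x tx; rewrite /normalizing_field oppr_ge0 oppr_le0.
rewrite map_mxN map_mxD scalerN; congr (- _).
have conj_plus k : map_mx conjc (I_plus a x *m X k a x) =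
    - (-1) ^ k *: (I_minus a x *m X (- k) a x).
  rewrite map_mxM conj_I_plus (rX k a x tx) -scalemxAr.
  by rewrite mulNmx scalerN scaleNr.
have conj_minus k : map_mx conjc (I_minus a x *m X k a x) =
    - (-1) ^ k *: (I_plus a x *m X (- k) a x).
  rewrite map_mxM conj_I_minus (rX k a x tx) -scalemxAr.
  by rewrite mulNmx scalerN scaleNr.
have sgnS : - (-1) ^ (n + 1) = (-1) ^ n :> R[i].
  by rewrite exprzDr ?unitrN1 // expr1z mulrN1 opprK.
have sgnP : - (-1) ^ (n - 1) = (-1) ^ n :> R[i].
  by rewrite exprzDr ?unitrN1 // exprN1 invrN1 mulrN1 opprK.
rewrite addrC scalerDr; congr (_ + _).
  case: ifP => _; last by rewrite map_mx0 scaler0.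
  by rewrite conj_plus sgnP opprB addrC.
case: ifP => _; last by rewrite map_mx0 scaler0.
by rewrite conj_minus sgnS opprD.
Qed.

(** The term I_- Y_{n+1} vanishes, as I_- squares to zero; the term
    I_+ Y_{n-1} = - I_+ I_- X_n reduces X_n to its projection I_- I_+ X_n, also
    for n = 1, when the extra summand of Y_0 is killed by I_+; and I_0 Y_n
    already lies in the image of I_-. *)
Lemma redefine_pos (X : int -> cvfield M) n a x : target (atlas a) x -> 0 < n ->
  redefine X (normalizing_field X) n a x =
  I_minus a x *m (I_plus a x *m X n a x - ii *: X (n + 1) a x).
Proof.
move=> tx n0.
have PY : I_plus a x *m normalizing_field X (n - 1) a x =
    - (I_plus a x *m I_minus a x *m X n a x).
  rewrite /normalizing_field subrK mulmxN; have -> : 0 <= n - 1 by lia.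
  rewrite mulmxDr mulmxA; case: ifP => _; last by rewrite mulmx0 addr0.
  by rewrite [in X in _ + X]mulmxA I_plus_plus // mul0mx addr0.
have ZY : I_zero a x *m normalizing_field X n a x =
    - (ii *: (I_minus a x *m X (n + 1) a x)).
  rewrite /normalizing_field; have -> : 0 <= n by lia.
  have -> : (n <= 0) = false by lia.
  by rewrite addr0 mulmxN mulmxA I_zero_minus // scalemxAl.
have QY : I_minus a x *m normalizing_field X (n + 1) a x = 0.
  rewrite /normalizing_field; have -> : 0 <= n + 1 by lia.
  have -> : (n + 1 <= 0) = false by lia.
  by rewrite addr0 mulmxN mulmxA I_minus_minus // mul0mx oppr0.
rewrite /redefine PY ZY QY addr0 mulmxBr mulmxA scalemxAr; congr (_ - _).
by rewrite -{1}[X n a x]mul1mx -(I_plus_minus_anticomm tx) mulmxDl addrC addKr.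
Qed.

(** The complex conjugate of the argument for [redefine_pos]. *)
Lemma redefine_neg (X : int -> cvfield M) n a x : target (atlas a) x -> n < 0 ->
  redefine X (normalizing_field X) n a x =
  I_plus a x *m (I_minus a x *m X n a x + ii *: X (n - 1) a x).
Proof.
move=> tx n0.
have PY : I_plus a x *m normalizing_field X (n - 1) a x = 0.
  rewrite /normalizing_field; have -> : (0 <= n - 1) = false by lia.
  have -> : n - 1 <= 0 by lia.
  by rewrite add0r mulmxN mulmxA I_plus_plus // mul0mx oppr0.
have ZY : I_zero a x *m normalizing_field X n a x =
    ii *: (I_plus a x *m X (n - 1) a x).
  rewrite /normalizing_field; have -> : (0 <= n) = false by lia.
  have -> : n <= 0 by lia.
  by rewrite add0r mulmxN mulmxA I_zero_plus // scaleNr mulNmx opprK scalemxAl.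
have QY : I_minus a x *m normalizing_field X (n + 1) a x =
    - (I_minus a x *m I_plus a x *m X n a x).
  rewrite /normalizing_field addrK mulmxN; have -> : n + 1 <= 0 by lia.
  rewrite mulmxDr [in X in _ + X]mulmxA; case: ifP => _.
    by rewrite mulmxA I_minus_minus // mul0mx add0r.
  by rewrite mulmx0 add0r.
rewrite /redefine PY ZY QY addr0 mulmxDr mulmxA scalemxAr addrAC; congr (_ + _).
by rewrite -{1}[X n a x]mul1mx -(I_plus_minus_anticomm tx) mulmxDl addrK.
Qed.

End HiddenActionRedefinition.

Theorem lemma23 (R : realType) (m : nat) (M : hyperkahler R m)
    (j : int) (j_gt1 : 1 < j)
    (X : int -> cvfield M) (hX : hidden_action j X) :
  exists Y : int -> cvfield M,
    redefinition_field j Y /\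
    (forall n : int, 0 < n -> section_T10 (redefine X Y n)) /\
    (forall n : int, n < 0 -> section_T01 (redefine X Y n)).
Proof.
have [vX sX rX _ _] := hX; exists (normalizing_field X).
have vY k : is_cvfield (normalizing_field X k).
  exact: is_cvfield_normalizing_field.
split.
  split=> //; first exact: supported_normalizing_field.
  exact: reality_normalizing_field.
split=> n n0; (split; first exact: is_cvfield_redefine) => a x tx.
- by rewrite redefine_pos // mulmxA I_zero_minus // scalemxAl.
- by rewrite redefine_neg // mulmxA I_zero_plus // scalemxAl.
Qed.
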